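(* Let $p$ be a prime with $p\equiv 1 \pmod 8$. A Type $O$ almost difference set exists in $\mathrm{GF}(p)$ (that is, the set of octic residues modulo $p$, without zero, is a $(p,k,\lambda,t)$-almost difference set in the additive group of $\mathrm{GF}(p)$ for some $k,\lambda,t$) if and only if $p=17$, or $p=41$, or $p$ is a prime such that $p = 8s^2+49 = 64u^2+441$ with $s$ an odd integer and $u$ an even integer.
   Context: The octic residues modulo a prime $p$ are the elements $x^8$ with $x\in \mathrm{GF}(p)^*$ (so zero is not included). For a finite group $G$ of order $v$ (written additively), a $k$-subset $D$ of $G$ is a $(v,k,\lambda,t)$-almost difference set if $t$ of the nonzero elements of $G$ occur exactly $\lambda$ times as differences $d-d'$ with $d,d'\in D$, and the other $v-1-t$ nonzero elements occur exactly $\lambda+1$ times.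
   Formalization: ''Almost difference set'' is taken to be proper, 0 < t < p-1, so ordinary difference sets are excluded; otherwise the claim fails at p = 73, where the octic residues form a (73,9,1) difference set. *)

(* Defs.v *)
From HB Require Import structures.
From mathcomp Require Import all_boot all_order all_algebra.

Set Implicit Arguments.
Unset Strict Implicit.
Unset Printing Implicit Defensive.

Import GRing.Theory.
Local Open Scope ring_scope.

Definition diff_count (G : finZmodType) (D : {set G}) (g : G) : nat :=
  #|[set dd : G * G | [&& dd.1 \in D, dd.2 \in D & dd.1 - dd.2 == g]]|.

(* The nonzero elements not among the t counted ones number v - 1 - t, so this
   cardinality needs no separate clause. The extreme cases t = 0 and t = v - 1,
   in which D is an ordinary difference set, satisfy this predicate. *)
Definition almost_difference_set (G : finZmodType) (v k lambda t : nat)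
    (D : {set G}) : Prop :=
  [/\ #|G| = v,
      #|D| = k,
      #|[set g : G | (g != 0) && (diff_count D g == lambda)]| = t
    & forall g : G, g != 0 -> diff_count D g <> lambda ->
        diff_count D g = lambda.+1].

Definition octic_residues (p : nat) : {set 'F_p} :=
  [set x ^+ 8 | x : 'F_p & x != 0].

(* The bounds on t exclude difference sets: for p = 73 the octic residues form
   a (73, 9, 1) difference set, which is not counted as an almost difference
   set of Type O. *)
Definition typeO_almost_difference_set (p : nat) : Prop :=
  exists k lambda t : nat,
    (0 < t < p.-1)%N /\
    almost_difference_set p k lambda t (octic_residues p).

(* Main.v *)
Require Import Defs.
From mathcomp Require Import all_boot all_order all_algebra.
From mathcomp Require Import all_solvable all_field.
From mathcomp Require Import zify ring.

Set Implicit Arguments.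
Unset Strict Implicit.
Unset Printing Implicit Defensive.

Import Order.TTheory GRing.Theory Num.Theory.
Local Open Scope ring_scope.

(** Write p = 8 f + 1. Counting the pairs of octic residues with difference g
    by characters of order 8 gives, for a primitive root w,
      64 * diff_count (w^k) = sum over i, j < 8 of chi^(i+j)(w^k) chi^j(-1) J(i,j),
    where J(i,j) is the Jacobi sum of chi^i and chi^j; in particular the count
    depends only on k modulo 8. The Jacobi sums are all determined by two of
    them. Three identities suffice: the symmetry [J_twist], the duplication
    formula [J_duplication] and the associativity [J_assoc] obtained by
    evaluating a double sum in two ways. They express every J(i,j) through
      J(1,3) = a + b sqrt(-2)   and   J(2,2) = x + y i
    ([J_table]), their conjugates, the sign e = chi(-1) = (-1)^f, and the sign
    o = chi(4), which tells whether 2 is a fourth power. The same identities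
    give p = a^2 + 2 b^2 = x^2 + y^2. The result is a list of eight explicit
    linear forms in a, b, x, y, the values 64 * diff_count
    ([octic_diff_counts]).

    What is left is arithmetic: when do these eight numbers take exactly two
    values, which differ by 64? Comparing differences of the entries shows that
    e = o = 1 is impossible, that the two cases with o = -1 force y^2 = 16 and,
    p being prime, p = 17 or 41, and that e = -1, o = 1 leaves six pairs (a, x).
    Since the entries are divisible by 64, congruences for
    a^2 + 2 b^2 = x^2 + y^2 modulo 64 and 3 exclude all of them but (a, x) = (-7, -21), which gives
    p = 8 s^2 + 49 = 64 u^2 + 441 with s odd; that u is even comes from a
    factorization of s^2 - 49 = 8 u^2 ([even_of_two_forms]).

    Conversely, the representations of a prime by a^2 + 2 b^2 and x^2 + y^2 are
    unique up to signs and order ([prime_sqr_form_unique]), and the divisibility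
    of the entries by 64 settles the remaining signs, including o. *)

(** * Multiplicative characters and Jacobi sums of a finite field *)

Section JacobiSums.

Context {F : finFieldType} {R : idomainType}.
Implicit Types (chi alpha beta gamma rho : F -> R).

(** Every multiplicative character vanishes at 0, the trivial one included:
    with this convention products of characters are pointwise products. *)
Definition mulchar chi :=
  [/\ chi 0 = 0, chi 1 = 1 & {morph chi : x y / x * y}].

Definition jacobi alpha beta : R := \sum_x alpha x * beta (1 - x).

Lemma eq_jacobi alpha alpha' beta beta' :
  alpha =1 alpha' -> beta =1 beta' -> jacobi alpha beta = jacobi alpha' beta'.
Proof. by move=> ea eb; apply: eq_bigr => x _; rewrite ea eb. Qed.

Lemma subr_involutive (s : F) : involutive (fun x => s - x).
Proof. by move=> x; rewrite subKr. Qed.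

Lemma jacobiC alpha beta : jacobi alpha beta = jacobi beta alpha.
Proof.
rewrite /jacobi (reindex_inj (can_inj (subr_involutive 1))) /=.
by apply: eq_bigr => x _; rewrite subKr mulrC.
Qed.

(** Translating the sum by u multiplies it by chi u. *)
Lemma sum_mulchar chi u :
  mulchar chi -> u != 0 -> chi u != 1 -> \sum_x chi x = 0.
Proof.
move=> [_ _ chiM] u0 chiu; apply/eqP.
have/eqP: chi u * \sum_x chi x = \sum_x chi x.
  rewrite [RHS](reindex_inj (mulfI u0)) /= mulr_sumr.
  by apply: eq_bigr => x _; rewrite chiM.
by rewrite -subr_eq0 -{2}[\sum_x _]mul1r -mulrBl mulf_eq0 subr_eq0 (negPf chiu).
Qed.

(** The substitution x = t / (t - 1), an involution of the elements other than
    1, turns alpha (x) beta (1 - x) into alpha (-1) alpha (t) gamma (1 - t). *)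
Lemma jacobi_twist alpha beta gamma :
  mulchar alpha -> mulchar beta -> mulchar gamma ->
  (forall x, x != 0 -> alpha x * beta x * gamma x = 1) ->
  jacobi alpha beta = alpha (-1) * jacobi alpha gamma.
Proof.
move=> [a0 a1 aM] [b0 b1 bM] [c0 c1 cM] abc.
rewrite /jacobi (bigD1 1) //= [\sum_x alpha x * gamma _](bigD1 1) //=.
rewrite subrr b0 c0 !mulr0 !add0r mulr_sumr.
pose h (t : F) := t / (t - 1).
have hK t : t != 1 -> h (h t) = t.
  move=> t1; rewrite /h; field.
  by rewrite subr_eq0 t1 mulN1r opprB addrC subrK oner_eq0.
have h1 t : t != 1 -> h t != 1.
  move=> t1; rewrite -subr_eq0 /h (_ : _ - 1 = (t - 1)^-1) ?invr_eq0 ?subr_eq0 //.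
  by field; rewrite subr_eq0.
rewrite (reindex_onto h h) => [|t t1]; last exact: hK.
rewrite (eq_bigl (fun t => t != 1)) => [|t]; last first.
  case: (eqVneq t 1) => [->|t1]; last by rewrite hK // eqxx h1.
  by rewrite /h subrr invr0 mulr0 mul0r [0 == 1]eq_sym oner_eq0 andbF.
apply: eq_bigr => t t1.
have s0 : 1 - t != 0 by rewrite subr_eq0 eq_sym.
have -> : h t = -1 * t * (1 - t)^-1.
  rewrite /h; field.
  by rewrite s0 subr_eq0 t1.
have -> : 1 - -1 * t / (1 - t) = (1 - t)^-1 by field.
rewrite !aM -!mulrA; congr (_ * (_ * _)).
rewrite -[LHS]mulr1 -c1 -[in gamma 1](mulVf s0) cM !mulrA abc ?invr_eq0 //.
by rewrite mul1r.
Qed.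

Lemma jacobi_unit alpha epsilon :
  alpha 0 = 0 -> alpha 1 = 1 -> (forall x, epsilon x = (x != 0)%:R) ->
  jacobi alpha epsilon = \sum_x alpha x - 1.
Proof.
move=> a0 a1 e; rewrite /jacobi (bigD1 1) //= [in RHS](bigD1 1) //= a1.
rewrite e subrr eqxx mulr0 add0r [in RHS]addrAC subrr add0r.
by apply: eq_bigr => x x1; rewrite e subr_eq0 eq_sym x1 mulr1.
Qed.

(** Rescaling by s reduces the additive convolution of two characters to their
    Jacobi sum. *)
Lemma convolution_mulchar alpha beta s :
  mulchar alpha -> mulchar beta ->
  \sum_x alpha x * beta (s - x) =
    if s == 0 then beta (-1) * \sum_x alpha x * beta x
    else alpha s * beta s * jacobi alpha beta.
Proof.
move=> [_ _ aM] [_ _ bM]; have [->|s0] /= := eqVneq s 0.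
  rewrite mulr_sumr; apply: eq_bigr => x _.
  by rewrite sub0r -[- x]mulN1r bM mulrCA.
rewrite (reindex_inj (mulfI s0)) mulr_sumr; apply: eq_bigr => x _ /=.
by rewrite -[s in s - _]mulr1 -mulrBr aM bM mulrACA.
Qed.

Lemma triple_jacobi alpha beta gamma :
  mulchar alpha -> mulchar beta -> mulchar gamma ->
  \sum_x \sum_y alpha x * beta y * gamma (1 - (x + y)) =
    jacobi alpha beta * jacobi (fun x => alpha x * beta x) gamma
    + beta (-1) * \sum_x alpha x * beta x.
Proof.
move=> ha hb [g0 g1 gM].
transitivity (\sum_s (\sum_x alpha x * beta (s - x)) * gamma (1 - s)).
  under [RHS]eq_bigr do rewrite mulr_suml.
  rewrite [RHS]exchange_big /=; apply: eq_bigr => x _.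
  rewrite (reindex_inj (addrI (- x))) /=; apply: eq_bigr => s _.
  by rewrite addrA subrr add0r [- x + s]addrC.
rewrite (bigD1 0) //= convolution_mulchar // eqxx subr0 g1 mulr1 addrC.
congr (_ + _); rewrite [X in _ * X](bigD1 0) //=.
have [-> _ _] := ha; rewrite !mul0r add0r mulr_sumr.
apply: eq_bigr => s s0; rewrite convolution_mulchar // (negPf s0).
by ring.
Qed.

(** The sum of alpha(x) beta(y) gamma(z) over x + y + z = 1 can be computed by
    grouping x with y or y with z. The terms beside the products come from the
    groups with sum 0; they vanish unless alpha beta, resp. beta gamma, is
    trivial. *)
Lemma jacobi_assoc alpha beta gamma :
  mulchar alpha -> mulchar beta -> mulchar gamma ->
  jacobi alpha beta * jacobi (fun x => alpha x * beta x) gamma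
    + beta (-1) * \sum_x alpha x * beta x =
  jacobi beta gamma * jacobi (fun x => beta x * gamma x) alpha
    + gamma (-1) * \sum_x beta x * gamma x.
Proof.
move=> ha hb hc; rewrite -!triple_jacobi // exchange_big /=.
apply: eq_bigr => y _; rewrite (reindex_inj (can_inj (subr_involutive (1 - y)))) /=.
apply: eq_bigr => z _; rewrite (_ : 1 - (1 - y - z + y) = z); last by ring.
by rewrite (_ : 1 - y - z = 1 - (y + z)); ring.
Qed.

(** Since 4 x (1 - x) = 1 - (2 x - 1)^2, the left-hand side is the sum of
    alpha (1 - y^2) over y, and 1 + rho counts the square roots. *)
Lemma jacobi_duplication alpha rho :
  mulchar alpha -> 2 != 0 :> F ->
  (forall x, #|[pred y | y ^+ 2 == x]|%:R = 1 + rho x) ->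
  alpha 4 * jacobi alpha alpha = \sum_x alpha x + jacobi alpha rho.
Proof.
move=> [a0 a1 aM] two hr; rewrite /jacobi mulr_sumr.
transitivity (\sum_(y : F) alpha (1 - y ^+ 2)).
  rewrite [RHS](reindex_inj (addIr (- 1))) [RHS](reindex_inj (mulfI two)) /=.
  by apply: eq_bigr => x _; rewrite -!aM; congr alpha; ring.
rewrite (partition_big (fun y => y ^+ 2) predT) //=.
rewrite -big_split (reindex_inj (can_inj (subr_involutive 1))) /=.
apply: eq_bigr => x _.
under eq_bigr => y /eqP-> do [].
rewrite sumr_const.
by rewrite subKr -mulr_natr hr mulrDr mulr1.
Qed.

End JacobiSums.

(** * Characters of order 8 *)

Lemma finField_primitive_root (F : finFieldType) :
  {w : F | #|F|.-1.-primitive_root w}.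
Proof.
apply: sigW.
have q1 : (1 < #|F|)%N := finNzRing_gt1 F.
have [|||w _ hw] := hasP (@has_prim_root F #|F|.-1
  (enum [pred x : F | x != 0]) _ _ (enum_uniq _) _); last by exists w.
- by lia.
- apply/allP => x; rewrite mem_enum inE => x0.
  rewrite unity_rootE; apply/eqP/(mulfI x0).
  by rewrite mulr1 -exprS prednK ?expf_card //; lia.
by rewrite -cardE (cardC1 (0 : F)).
Qed.

Section OcticCharacters.

Context (F : finFieldType) (f : nat) (cardF : #|F| = (8 * f).+1).
Context (w : F) (prim_w : (8 * f).-primitive_root w).

Lemma eighth_order_gt0 : (0 < f)%N.
Proof. by have := prim_order_gt0 prim_w; rewrite muln_gt0 => /andP[]. Qed.

Lemma primitive_root_neq0 e : w ^+ e != 0.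
Proof.
rewrite expf_neq0 //; apply/eqP => w0.
have := prim_expr_order prim_w; rewrite w0 expr0n.
by have := eighth_order_gt0; case: f => // n _ /eqP; rewrite eq_sym oner_eq0.
Qed.

Lemma unit_powP x : x != 0 -> exists e, x = w ^+ e.
Proof.
move=> x0; have [|e ->] := prim_rootP prim_w (_ : x ^+ (8 * f) = 1).
  by apply: (mulfI x0); rewrite mulr1 -exprS -cardF expf_card.
by exists e.
Qed.

Definition dlog (x : F) : nat :=
  if [pick e : 'I_(8 * f) | w ^+ e == x] is Some e then e else 0%N.

Lemma dlogK x : x != 0 -> w ^+ dlog x = x.
Proof.
move=> /unit_powP[e ->]; rewrite /dlog; case: pickP => [i /eqP //|no].
have lt_e : (e %% (8 * f) < 8 * f)%N by rewrite ltn_mod (prim_order_gt0 prim_w).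
by have := no (Ordinal lt_e); rewrite /= (prim_expr_mod prim_w) eqxx.
Qed.

Lemma dlog_expr e : dlog (w ^+ e) = e %[mod 8].
Proof.
have /eqP := dlogK (primitive_root_neq0 e).
rewrite (eq_prim_root_expr prim_w) => /eqP h.
by rewrite -(modn_dvdm (dlog _) (dvdn_mulr f (dvdnn 8))) h modn_dvdm ?dvdn_mulr.
Qed.

Lemma expr_half_order : w ^+ (4 * f) = -1.
Proof.
have := prim_expr_order prim_w; rewrite (_ : 8 * f = 4 * f * 2)%N; last by lia.
rewrite exprM => /eqP; rewrite sqrf_eq1 => /orP[|/eqP //].
by rewrite -(prim_order_dvd prim_w); move/dvdn_leq; have := eighth_order_gt0; lia.
Qed.

Lemma two_neq0 : 2 != 0 :> F.
Proof.
apply/eqP => two; have : w ^+ (4 * f) = 1.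
  by apply/eqP; rewrite expr_half_order eq_sym -subr_eq0 opprK -(natrD _ 1 1) two.
move/eqP; rewrite -(prim_order_dvd prim_w); move/dvdn_leq; have := eighth_order_gt0; lia.
Qed.

(** With t = w^f, of order 8, this is (t + t^-1)^2 = t^2 + t^-2 + 2 and
    t^4 = -1. *)
Lemma two_is_square : 2 = (w ^+ f + w ^+ (7 * f)) ^+ 2.
Proof.
have e8 := prim_expr_order prim_w; have e4 := expr_half_order.
rewrite !(mulnC _ f) !exprM in e8 e4 *.
by ring: e4.
Qed.

Context (z : algC) (prim_z : 8.-primitive_root z).

Lemma zeta8_pow4 : z ^+ 4 = -1.
Proof.
have := prim_expr_order prim_z; rewrite (exprM z 4 2) => /eqP.
rewrite sqrf_eq1 => /orP[|/eqP //].
by rewrite -(prim_order_dvd prim_z).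
Qed.

Definition ochar (k : nat) (x : F) : algC :=
  if x == 0 then 0 else z ^+ (k * dlog x).

Lemma zeta8_mod i j : i = j %[mod 8] -> z ^+ i = z ^+ j.
Proof. by move=> h; apply/eqP; rewrite (eq_prim_root_expr prim_z); apply/eqP. Qed.

Lemma ochar_expr k e : ochar k (w ^+ e) = z ^+ (k * e).
Proof.
rewrite /ochar (negPf (primitive_root_neq0 e)); apply: zeta8_mod.
by rewrite -modnMmr dlog_expr modnMmr.
Qed.

Lemma ochar0 k : ochar k 0 = 0.
Proof. by rewrite /ochar eqxx. Qed.

Lemma ochar_mulchar k : mulchar (ochar k).
Proof.
split; first exact: ochar0.
  by rewrite -(expr0 w) ochar_expr muln0 expr0.
move=> x y; have [->|/unit_powP[i ->]] := eqVneq x 0.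
  by rewrite mul0r ochar0 mul0r.
have [->|/unit_powP[j ->]] := eqVneq y 0; first by rewrite mulr0 ochar0 mulr0.
by rewrite -exprD !ochar_expr mulnDr exprD.
Qed.

Lemma ocharM k : {morph ochar k : x y / x * y}.
Proof. by case: (ochar_mulchar k). Qed.

Lemma ocharD i j x : ochar i x * ochar j x = ochar (i + j) x.
Proof.
rewrite /ochar; case: eqP => _; first by rewrite mulr0.
by rewrite mulnDl exprD.
Qed.

Lemma ochar_mod i j : i = j %[mod 8] -> ochar i =1 ochar j.
Proof.
move=> h x; rewrite /ochar; case: eqP => // _; apply: zeta8_mod.
by rewrite -modnMml h modnMml.
Qed.

Lemma ochar_triv x : ochar 0 x = (x != 0)%:R.
Proof. by rewrite /ochar; case: eqP. Qed.

Lemma sum_ochar k : \sum_x ochar k x = if (8 %| k)%N then (8 * f)%:R else 0.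
Proof.
case: ifP => dk.
  rewrite (eq_bigr (fun x => (x != 0)%:R)) => [|x _]; last first.
    by rewrite -ochar_triv; apply: ochar_mod; rewrite (eqP dk).
  rewrite -natr_sum; congr (_%:R); rewrite -big_mkcond sum1_card.
  by rewrite (cardC1 (0 : F)) cardF.
apply: (sum_mulchar (ochar_mulchar k) (primitive_root_neq0 1)).
by rewrite ochar_expr muln1 -(prim_order_dvd prim_z) dk.
Qed.

Lemma ocharX k x e : x != 0 -> ochar k (x ^+ e) = ochar (k * e) x.
Proof.
by move=> /unit_powP[i ->]; rewrite -exprM !ochar_expr mulnAC mulnA.
Qed.

Definition eps : algC := (-1) ^+ f.

Lemma ocharN1 k : ochar k (-1) = eps ^+ k.
Proof.
by rewrite -expr_half_order ochar_expr mulnCA exprM zeta8_pow4 mulnC exprM.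
Qed.

Definition omega : algC := ochar 1 4.

Lemma ochar4 k : ochar k 4 = omega ^+ k.
Proof.
have F4 : 4 != 0 :> F by rewrite (natrM _ 2 2) mulf_neq0 ?two_neq0.
by rewrite /omega -{2}(mul1n k) /ochar (negPf F4) -exprM !mul1n mulnC.
Qed.

(** This is chi^4(2) = 1: 2 is a square, as the order of F is 1 modulo 8. *)
Lemma omega_sqr : omega ^+ 2 = 1.
Proof.
rewrite -ochar4 (natrX _ 2 2) ocharX ?two_neq0 // two_is_square ocharX; last first.
  by apply: contraNneq two_neq0 => t0; rewrite two_is_square t0 expr0n.
rewrite (@ochar_mod _ 0) // ochar_triv.
case: eqP => // t0; have := two_neq0.
by rewrite two_is_square t0 expr0n eqxx.
Qed.

Lemma eps_sqr : eps ^+ 2 = 1.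
Proof. by rewrite -exprM mulnC exprM sqrrN expr1n expr1n. Qed.

(** * Jacobi sums of the characters of order 8 *)

Definition J i j := jacobi (ochar i) (ochar j).

Lemma J_mod i i' j j' : i = i' %[mod 8] -> j = j' %[mod 8] -> J i j = J i' j'.
Proof. by move=> hi hj; apply: eq_jacobi; apply: ochar_mod. Qed.

Lemma JC i j : J i j = J j i.
Proof. exact: jacobiC. Qed.

Lemma J_twist i j k : (8 %| i + j + k)%N -> J i j = eps ^+ i * J i k.
Proof.
move=> h; rewrite -ocharN1; apply: jacobi_twist; try exact: ochar_mulchar.
move=> x x0; rewrite !ocharD (@ochar_mod _ 0) ?ochar_triv ?x0 //.
by rewrite (eqP h).
Qed.

Lemma J_triv i : J i 0 = \sum_x ochar i x - 1.
Proof. by have [h0 h1 _] := ochar_mulchar i; apply: jacobi_unit h0 h1 ochar_triv. Qed.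

Lemma J_assoc i j k :
  J i j * J (i + j) k + eps ^+ j * \sum_x ochar (i + j) x =
  J j k * J (j + k) i + eps ^+ k * \sum_x ochar (j + k) x.
Proof.
have := jacobi_assoc (ochar_mulchar i) (ochar_mulchar j) (ochar_mulchar k).
rewrite !ocharN1 !(eq_bigr _ (fun x _ => ocharD _ _ x)).
by rewrite !(eq_jacobi (ocharD _ _) (frefl _)).
Qed.

Lemma card_sqrt x : #|[pred y : F | y ^+ 2 == x]|%:R = 1 + ochar 4 x.
Proof.
have [->|/unit_powP[e ->]] := eqVneq x 0.
  rewrite ochar0 addr0 (@eq_card _ _ (pred1 (0 : F))) ?card1 // => y.
  by rewrite !inE sqrf_eq0.
rewrite ochar_expr exprM zeta8_pow4 -signr_odd.
case: (boolP (odd e)) => odd_e.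
  rewrite subrr (_ : #|_| = 0%N) //; apply: eq_card0 => y; rewrite !inE.
  apply/negP => /eqP hy; have y0 : y != 0.
    apply: contraNneq (primitive_root_neq0 e) => y0.
    by rewrite -hy y0 expr0n.
  have d2 : (2 %| 8 * f)%N by rewrite dvdn_mulr.
  have [i yi] := unit_powP y0; move: hy => /eqP.
  rewrite yi -exprM (eq_prim_root_expr prim_w) => /eqP.
  by move=> /(congr1 (modn^~ 2)) /=; rewrite !(modn_dvdm _ d2) !modn2 oddM odd_e andbF.
have [i ->] : exists i, e = (i * 2)%N by exists e./2; rewrite muln2 even_halfK.
rewrite exprM expr0 (@eq_card _ _ (pred2 (w ^+ i) (- w ^+ i))).
  rewrite card2 -subr_eq0 opprK -[w ^+ i]mulr1 -mulrDr mulf_eq0.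
  by rewrite (negPf two_neq0) (negPf (primitive_root_neq0 i)).
by move=> y; rewrite !inE eqf_sqr.
Qed.

Lemma J_duplication i : omega ^+ i * J i i = \sum_x ochar i x + J i 4.
Proof.
by rewrite -ochar4; apply: jacobi_duplication (ochar_mulchar i) two_neq0 card_sqrt.
Qed.

(** J (i, c i) is a sum of powers of z^i; these are the multiplicities of the
    exponents. They do not depend on i, so that conjugate Jacobi sums share
    their coefficients. *)
Definition jacobi_fiber c (k : 'I_8) : nat :=
  #|[pred x : F | [&& x != 0, x != 1 &
                      ((dlog x + c * dlog (1 - x)%R) %% 8 == k)%N]]|.

Lemma J_fiber_sum c i :
  J i (c * i) = \sum_(k < 8) z ^+ (i * k) *+ jacobi_fiber c k.
Proof.
transitivity (\sum_(x : F | (x != 0) && (x != 1))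
                 z ^+ (i * (dlog x + c * dlog (1 - x)%R))).
  rewrite [RHS]big_mkcond; apply: eq_bigr => x _; rewrite /ochar subr_eq0 (eq_sym 1).
  case: eqP => _; rewrite ?mul0r //; case: eqP => _; rewrite ?mulr0 //= -exprD.
  by congr (_ ^+ _); lia.
rewrite (partition_big (fun x => inZp (dlog x + c * dlog (1 - x)%R) : 'I_8) predT) //=.
apply: eq_bigr => k _; rewrite -sumr_const.
apply: eq_big => [x|x /andP[_ /eqP<-]]; first by rewrite !inE -andbA -val_eqE.
by apply: zeta8_mod; rewrite /= modnMmr.
Qed.

(** Exchanging x and 1 - x maps the exponent m + 3 n to n + 3 m, which is
    3 (m + 3 n) modulo 8. Hence J (1, 3) is fixed by z -> z^3 and lies in the
    ring generated by sqrt(-2) = z + z^3. *)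
Lemma jacobi_fiber3_sym (k k' : 'I_8) :
  (3 * k = k' %[mod 8])%N -> jacobi_fiber 3 k = jacobi_fiber 3 k'.
Proof.
move=> h; rewrite /jacobi_fiber -!sum1_card.
rewrite [RHS](reindex_inj (can_inj (@subr_involutive F 1))) /=.
apply: eq_bigl => x; have x1 : (1 - x == 1) = (x == 0).
  by rewrite -subr_eq0 addrAC subrr add0r oppr_eq0.
rewrite !inE x1 subKr subr_eq0 (eq_sym 1) andbCA.
case: eqP => //= _; case: eqP => //= _; have := ltn_ord k; have := ltn_ord k'; move: h.
by move: (dlog x) (dlog (1 - x)) => m n; lia.
Qed.

Lemma J_integral : exists a b x y : int,
  [/\ J 1 3 = a%:~R + b%:~R * (z + z ^+ 3),
      J 5 7 = a%:~R - b%:~R * (z + z ^+ 3),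
      J 2 2 = x%:~R + y%:~R * z ^+ 2 &
      J 6 6 = x%:~R - y%:~R * z ^+ 2].
Proof.
pose h c k := (jacobi_fiber c (inord k))%:Z.
exists (h 3 0%N - h 3 4), (h 3 1%N - h 3 5).
exists (h 1%N 0%N + h 1%N 4 - h 1%N 2 - h 1%N 6).
exists (h 1%N 1%N + h 1%N 5 - h 1%N 3 - h 1%N 7).
have Jh c i : J i (c * i) = \sum_(k < 8) (h c k)%:~R * z ^+ (i * k).
  by rewrite J_fiber_sum; apply: eq_bigr => k _; rewrite /h inord_val -mulr_natl.
have h13 : h 3 3%N = h 3 1%N
  by rewrite /h (@jacobi_fiber3_sym (inord 1) (inord 3)) ?inordK.
have h57 : h 3 7%N = h 3 5%N
  by rewrite /h (@jacobi_fiber3_sym (inord 5) (inord 7)) ?inordK.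
have h26 : h 3 6%N = h 3 2%N
  by rewrite /h (@jacobi_fiber3_sym (inord 2) (inord 6)) ?inordK.
have e4 := zeta8_pow4; clearbody h.
rewrite (@J_mod 5 5 7 (3 * 5)) // (Jh 3 1%N) (Jh 3 5) (Jh 1%N 2) (Jh 1%N 6).
rewrite !big_ord_recr !big_ord0 /= h13 h57 h26.
by split; ring: e4.
Qed.

(** Associativity for (chi, chi^3, chi^-3), where the second grouping meets the
    trivial character. *)
Lemma J_norm13 : J 1 3 * J 5 7 = #|F|%:R.
Proof.
have := J_assoc 1 3 5; rewrite !sum_ochar /= mulr0 addr0.
rewrite (JC 4 5) (@J_twist 5 4 7) // (@J_twist 3 5 0) // (@J_mod 8 0 1 1) //.
rewrite (JC 0 1) !J_triv !sum_ochar /= cardF -natr1.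
have := eps_sqr; move: eps => e e2 h.
have -> : J 1 3 * J 5 7 = e * (J 1 3 * (e ^+ 5 * J 5 7)) by ring: e2.
by rewrite h; ring: e2.
Qed.

Lemma J_norm22 : J 2 2 * J 6 6 = #|F|%:R.
Proof.
have := J_assoc 2 2 6; rewrite !sum_ochar /= mulr0 addr0.
rewrite (JC 4 6) (@J_twist 6 4 6) // (@J_twist 2 6 0) // (@J_mod 8 0 2 2) //.
rewrite (JC 0 2) !J_triv !sum_ochar /= cardF -natr1.
have := eps_sqr; move: eps => e e2 h.
have -> : J 2 2 * J 6 6 = J 2 2 * (e ^+ 6 * J 6 6) by ring: e2.
by rewrite h; ring: e2.
Qed.

(** The sums J (i, i) come from [J_duplication]. The relation
    J (1, 5) = o J (2, 2), the quadratic case of the Hasse-Davenport product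
    formula, and its conjugate come from [J_assoc] after cancelling J (1, 4).
    All others follow by [J_twist] and symmetry. *)
Lemma J_table :
  let e := eps in let o := omega in
  let K := J 1 3 in let K' := J 5 7 in let P := J 2 2 in let P' := J 6 6 in
  [/\ [/\ J 1 1 = o * e * K, J 1 2 = e * o * P, J 1 4 = e * K, J 1 5 = o * P
        & J 1 6 = o * K],
      [/\ J 2 3 = o * K, J 2 4 = P, J 2 5 = e * o * P & J 2 7 = o * K'],
      [/\ J 3 3 = o * e * K, J 3 4 = e * K, J 3 6 = e * o * P' & J 3 7 = o * P'],
      [/\ J 4 5 = e * K', J 4 6 = P' & J 4 7 = e * K'] &
      [/\ J 5 5 = o * e * K', J 5 6 = o * K', J 6 7 = e * o * P' & J 7 7 = o * e * K']].
Proof.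
move=> e o K K' P P'.
have e2 : e ^+ 2 = 1 := eps_sqr; have o2 : o ^+ 2 = 1 := omega_sqr.
have q0 : #|F|%:R != 0 :> algC by rewrite cardF pnatr_eq0.
have K0 : K != 0 by apply: contraNneq q0 => K0; rewrite -J_norm13 -/K K0 mul0r.
have dup i : ~~ (8 %| i)%N -> odd i -> J i i = o * J i 4.
  move=> hi oi; have := J_duplication i; rewrite sum_ochar (negPf hi) add0r => <-.
  rewrite -/o mulrA -exprS -[i.+1]even_halfK /= ?oi // -muln2 mulnC exprM o2.
  by rewrite expr1n mul1r.
have j14 : J 1 4 = e * K by rewrite (@J_twist 1 4 3).
have j34 : J 3 4 = e * K by rewrite (@J_twist 3 4 1) // (JC 3 1) -/e -/K; ring: e2.
have j45 : J 4 5 = e * K' by rewrite JC (@J_twist 5 4 7) // -/e -/K'; ring: e2.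
have j47 : J 4 7 = e * K' by rewrite JC (@J_twist 7 4 5) // (JC 7 5) -/e -/K'; ring: e2.
have j11 : J 1 1 = o * e * K by rewrite dup // j14; ring.
have j33 : J 3 3 = o * e * K by rewrite dup // j34; ring.
have j55 : J 5 5 = o * e * K' by rewrite dup // (JC 5) j45; ring.
have j77 : J 7 7 = o * e * K' by rewrite dup // (JC 7) j47; ring.
have j24 : J 2 4 = P by rewrite (@J_twist 2 4 2) // -/e e2 mul1r.
have j46 : J 4 6 = P' by rewrite JC (@J_twist 6 4 6) // -/e -/P'; ring: e2.
have eK0 : e * K != 0.
  by rewrite mulf_neq0 // -sqrf_eq0 e2 oner_eq0.
have j15 : J 1 5 = o * P.
  have := J_assoc 1 1 4; rewrite !sum_ochar /= !mulr0 !addr0 j11 j24 j14.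
  rewrite (JC 5 1) => h; apply: (mulfI eK0); rewrite -h; ring.
have j37 : J 3 7 = o * P'.
  have := J_assoc 3 3 4; rewrite !sum_ochar /= !mulr0 !addr0 j33 (JC 6) j46 j34.
  rewrite (JC 7 3) => h; apply: (mulfI eK0); rewrite -h; ring.
split; split=> //.
- by rewrite (@J_twist 1 2 5) // j15 -/e; ring.
- by rewrite (@J_twist 1 6 1) // j11 -/e; ring: e2.
- by rewrite JC (@J_twist 3 2 3) // j33 -/e; ring: e2.
- by rewrite JC (@J_twist 5 2 1) // (JC 5) j15 -/e; ring: e2.
- by rewrite JC (@J_twist 7 2 7) // j77 -/e; ring: e2.
- by rewrite (@J_twist 3 6 7) // j37 -/e; ring: e2.
- by rewrite (@J_twist 5 6 5) // j55 -/e; ring: e2.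
- by rewrite JC (@J_twist 7 6 3) // (JC 7) j37 -/e; ring: e2.
Qed.

(** * Difference counts of the octic residues *)

Definition octic_powers : {set F} := [set x ^+ 8 | x : F & x != 0].

Lemma mem_octic_powers e : (w ^+ e \in octic_powers) = (8 %| e)%N.
Proof.
apply/imsetP/idP => [[x]|/dvdnP[n ->]]; last first.
  by exists (w ^+ n); rewrite ?inE ?primitive_root_neq0 ?exprM.
rewrite inE => /unit_powP[n ->]; rewrite -exprM => /eqP.
rewrite (eq_prim_root_expr prim_w) => /eqP.
move=> /(congr1 (modn^~ 8)) /=; rewrite !(modn_dvdm _ (dvdn_mulr f (dvdnn 8))).
by rewrite modnMl /dvdn => ->.
Qed.

(** Orthogonality: the characters of order dividing 8 detect eighth powers. *)
Lemma sum_ochar_octic_powers x :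
  \sum_(i < 8) ochar i x = 8 * (x \in octic_powers)%:R.
Proof.
have [->|/unit_powP[e ->]] := eqVneq x 0.
  rewrite big1 => [|i _]; last by rewrite ochar0.
  case: imsetP => [[y]|]; last by rewrite mulr0.
  by rewrite inE => y0 /esym /eqP; rewrite expf_eq0 (negPf y0).
rewrite mem_octic_powers -(eq_bigr _ (fun i _ => esym (ochar_expr _ _))).
case: (boolP (8 %| e)%N) => [/dvdnP[n ->]|he].
  rewrite (eq_bigr (fun=> 1)) ?sumr_const ?card_ord ?mulr1 // => i _.
  by rewrite (@zeta8_mod _ 0) // mulnA modnMl.
rewrite mulr0 (eq_bigr (fun i : 'I_8 => (z ^+ e) ^+ i)) => [|i _]; last first.
  by rewrite mulnC exprM.
apply: (@mulfI _ (z ^+ e - 1)).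
  by rewrite subr_eq0 -(prim_order_dvd prim_z).
by rewrite -subrX1 -exprM mulnC exprM (prim_expr_order prim_z) expr1n subrr mulr0.
Qed.

Lemma diff_count_sum (D : {set F}) g :
  (diff_count D g)%:R = \sum_y ((y + g \in D)%:R * (y \in D)%:R) :> algC.
Proof.
rewrite /diff_count -sum1_card.
transitivity (\sum_(y : F | (y + g \in D) && (y \in D)) 1 : algC); last first.
  by rewrite big_mkcond; apply: eq_bigr => y _; do 2!case: (_ \in D); rewrite ?mulr1 ?mulr0.
rewrite natr_sum (reindex_onto (fun y => (y + g, y)) snd) /=.
  apply: eq_bigl => y; rewrite !inE /= eqxx andbT [y + g]addrC addrK eqxx andbT.
  by rewrite addrC.
by case=> x y; rewrite inE => /and3P[_ _ /eqP<-] /=; rewrite addrC subrK.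
Qed.

Lemma diff_count_jacobi k :
  64 * (diff_count octic_powers (w ^+ k))%:R =
  \sum_(i < 8) \sum_(j < 8) z ^+ ((k * (i + j)) %% 8) * eps ^+ j * J i j.
Proof.
rewrite diff_count_sum mulr_sumr.
transitivity (\sum_y \sum_(i < 8) \sum_(j < 8) ochar i (y + w ^+ k) * ochar j y).
  apply: eq_bigr => y _; under eq_bigr do rewrite -mulr_sumr.
  by rewrite -mulr_suml !sum_ochar_octic_powers; ring.
rewrite exchange_big; apply: eq_bigr => i _; rewrite exchange_big.
apply: eq_bigr => j _ /=.
rewrite (reindex_inj (mulfI (primitive_root_neq0 k))) (reindex_inj oppr_inj) /=.
rewrite (reindex_inj (can_inj (@subr_involutive F 1))) /=.
rewrite mulr_sumr; apply: eq_bigr => x _.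
have -> : w ^+ k * - (1 - x) + w ^+ k = w ^+ k * x by ring.
have -> : w ^+ k * - (1 - x) = w ^+ k * (-1 * (1 - x)) by ring.
rewrite !ocharM ocharN1 !ochar_expr.
rewrite (@zeta8_mod ((k * (i + j)) %% 8) (i * k + j * k)); last first.
  by rewrite modn_mod -mulnDl mulnC.
by rewrite exprD; ring.
Qed.

Definition jacobi_table (q e o K K' P P' : algC) (i j : nat) : algC :=
  nth 0 (nth [::]
    [:: [:: q - 2; -1; -1; -1; -1; -1; -1; -1];
        [:: -1; o * e * K; e * o * P; K; e * K; o * P; o * K; - e];
        [:: -1; e * o * P; P; o * K; P; e * o * P; -1; o * K'];
        [:: -1; K; o * K; o * e * K; e * K; - e; e * o * P'; o * P'];
        [:: -1; e * K; P; e * K; -1; e * K'; P'; e * K'];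
        [:: -1; o * P; e * o * P; - e; e * K'; o * e * K'; o * K'; K'];
        [:: -1; o * K; -1; e * o * P'; P'; o * K'; P'; e * o * P'];
        [:: -1; - e; o * K'; o * P'; e * K'; K'; e * o * P'; o * e * K']] i) j.

Lemma J_tableP (i j : nat) : (i < 8)%N -> (j < 8)%N ->
  J i j = jacobi_table #|F|%:R eps omega (J 1 3) (J 5 7) (J 2 2) (J 6 6) i j.
Proof.
move=> hi hj; rewrite /jacobi_table; set e := eps; set o := omega.
have e2 : e ^+ 2 = 1 := eps_sqr.
have [[j11 j12 j14 j15 j16] [j23 j24 j25 j27] [j33 j34 j36 j37]
  [j45 j46 j47] [j55 j56 j67 j77]] := J_table.
have j0 n : (n < 8)%N -> (0 < n)%N -> J n 0 = -1.
  by move=> n8 n0; rewrite J_triv sum_ochar gtnNdvd // sub0r.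
have j00 : J 0 0 = #|F|%:R - 2 by rewrite J_triv sum_ochar /= cardF -natr1; ring.
have j17 : J 1 7 = - e by rewrite (@J_twist 1 7 0) // j0 // -/e; ring.
have j26 : J 2 6 = -1 by rewrite (@J_twist 2 6 0) // j0 // -/e; ring: e2.
have j35 : J 3 5 = - e by rewrite (@J_twist 3 5 0) // j0 // -/e; ring: e2.
have j44 : J 4 4 = -1 by rewrite (@J_twist 4 4 0) // j0 // -/e; ring: e2.
wlog le_ij : i j hi hj / (i <= j)%N => [hw|].
  have [le_ij|/ltnW le_ji] := leqP i j; first exact: hw.
  rewrite JC (hw j i) //.
  by case: i hi {le_ji} => [|[|[|[|[|[|[|[|i]]]]]]]] // _;
    case: j hj => [|[|[|[|[|[|[|[|j]]]]]]]].
by case: i hi le_ij => [|[|[|[|[|[|[|[|i]]]]]]]] // _;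
  case: j hj => [|[|[|[|[|[|[|[|j]]]]]]]] //= _ _; rewrite // JC j0.
Qed.

End OcticCharacters.

(** The numbers 64 * diff_count (w^k) for k = 0, ..., 7. Write A_m for the
    coefficient of chi^m in the Fourier expansion of 64 * diff_count. Then
    A_0 = q - 9, A_4 is A4, and A2 is the real part of A_2. At k = 0 and k = 2
    the characters of odd index contribute S0 and S2 in total, and S1 at k = 1;
    T1 is the contribution of chi^2 and chi^6 at k = 1. *)
Definition octic_values (q e o a b x y : int) : seq int :=
  let A2 := -2 + 2 * o * a + 2 * (1 + e * o) * x in
  let A4 := -2 + 4 * e * a + 2 * x in
  let S0 := 4 * (1 + e) * (-1 + (1 + o) * a + o * x) in
  let S2 := 4 * (1 + e) * o * y in
  let T1 := 4 * (1 + e * o) * y in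
  let S1 := 4 * (1 + e) * (1 + o) * b in
  let E := q - 9 + A4 in
  let O := q - 9 - A4 in
  [:: E + 2 * A2 + S0; O + T1 + S1; E - 2 * A2 + S2; O - T1 + S1;
      E + 2 * A2 - S0; O + T1 - S1; E - 2 * A2 - S2; O - T1 - S1].

(** With the table of Jacobi sums and z^4 = -1, each of the eight values is a
    polynomial identity. *)
Theorem octic_diff_counts (F : finFieldType) (f : nat) (w : F) :
  #|F| = (8 * f).+1 -> (8 * f).-primitive_root w ->
  exists o a b x y : int,
    [/\ o = 1 \/ o = -1, #|F|%:Z = a ^+ 2 + 2 * b ^+ 2,
        #|F|%:Z = x ^+ 2 + y ^+ 2 &
        forall k, 64 * (diff_count (octic_powers F) (w ^+ k))%:Z =
          nth 0 (octic_values #|F|%:Z ((-1) ^+ f) o a b x y) (k %% 8)].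
Proof.
move=> cardF prim_w; have [z prim_z] := C_prim_root_exists (isT : (0 < 8)%N).
have e4 := zeta8_pow4 prim_z.
have [a [b [x [y [hK hK' hP hP']]]]] := J_integral cardF prim_w prim_z.
have [o oE oZ] : exists2 o : int, omega f w z = o%:~R & o = 1 \/ o = -1.
  have /eqP := omega_sqr cardF prim_w prim_z.
  by rewrite sqrf_eq1 => /orP[] /eqP ->; [exists 1 | exists (-1)]; tauto.
have eE : eps f = ((-1) ^+ f)%:~R by rewrite rmorphXn /= rmorphN1.
have ee : ((-1) ^+ f) ^+ 2 = 1 :> int by rewrite -exprM mulnC exprM expr1n.
have oo : o ^+ 2 = 1 by case: oZ => ->.
exists o, a, b, x, y; split=> //.
- have := J_norm13 cardF prim_w prim_z; rewrite hK hK' => h.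
  apply: (@intr_inj algC); rewrite -pmulrn -h.
  by rewrite rmorphD rmorphM !rmorphXn /=; ring: e4.
- have := J_norm22 cardF prim_w prim_z; rewrite hP hP' => h.
  apply: (@intr_inj algC); rewrite -pmulrn -h.
  by rewrite rmorphD !rmorphXn /=; ring: e4.
move=> k; apply: (@intr_inj algC); rewrite rmorphM /= -pmulrn.
rewrite (diff_count_jacobi cardF prim_w prim_z).
pose K : algC := a%:~R + b%:~R * (z + z ^+ 3).
pose K' : algC := a%:~R - b%:~R * (z + z ^+ 3).
pose P : algC := x%:~R + y%:~R * z ^+ 2.
pose P' : algC := x%:~R - y%:~R * z ^+ 2.
pose T := jacobi_table (#|F|%:Z)%:~R ((-1) ^+ f)%:~R o%:~R K K' P P'.
pose G (i j : nat) := z ^+ ((k %% 8 * (i + j)) %% 8) * ((-1) ^+ f)%:~R ^+ j * T i j.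
transitivity (\sum_(i < 8) \sum_(j < 8) G i j).
  apply: eq_bigr => i _; apply: eq_bigr => j _.
  rewrite (J_tableP cardF prim_w prim_z (ltn_ord i) (ltn_ord j)).
  by rewrite -modnMml eE oE hK hK' hP hP'.
have sum8 (H : nat -> algC) :
    \sum_(i < 8) H i = H 0 + H 1%N + H 2 + H 3 + H 4 + H 5 + H 6 + H 7.
  by rewrite !big_ord_recr big_ord0 /= add0r.
rewrite (sum8 (fun i => \sum_(j < 8) G i j)) !(sum8 (G _)) /G /T {G T}.
rewrite /jacobi_table /K /K' /P /P' {K K' P P'}.
move: (k %% 8)%N (ltn_mod k 8) => r /= r8.
move: #|F|%:Z ((-1) ^+ f) ee {eE} => q e ee.
have e2 : (e%:~R : algC) ^+ 2 = 1 by rewrite -rmorphXn ee.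
have o2 : (o%:~R : algC) ^+ 2 = 1 by rewrite -rmorphXn oo.
by case: r r8 => [|[|[|[|[|[|[|[|r]]]]]]]] //= _; ring: e4 e2 o2.
Qed.

(** * Squares and binary quadratic forms *)

Lemma coprime_mul_sqr m n u :
  coprime m n -> (m * n = u ^ 2)%N -> exists r, m = (r ^ 2)%N.
Proof.
move=> co_mn mnu; have [->|m0] := posnP m; first by exists 0%N.
have g0 : (0 < gcdn m u)%N by rewrite gcdn_gt0 m0.
exists (gcdn m u).
have /dvdnP[m' mE] := dvdn_gcdl m u; have /dvdnP[u' uE] := dvdn_gcdr m u.
have co : coprime m' u'.
  rewrite /coprime -(eqn_pmul2r g0) mul1n muln_gcdl -mE -uE.
  by rewrite eqxx.
have eq1 : (m' * n = gcdn m u * u' ^ 2)%N.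
  have : (gcdn m u * (m' * n) = gcdn m u * (gcdn m u * u' ^ 2))%N.
    by rewrite mulnA [(_ * m')%N]mulnC -mE mnu [in LHS]uE; lia.
  by move/eqP; rewrite eqn_pmul2l // => /eqP.
suff m'g : m' = gcdn m u by rewrite {1}mE m'g.
apply/eqP; rewrite eqn_dvd; apply/andP; split.
  by rewrite -(@Gauss_dvdl _ _ (u' ^ 2)) ?coprimeXr // -eq1 dvdn_mulr.
have co_gn : coprime (gcdn m u) n by apply: coprime_dvdl co_mn; apply: dvdn_gcdl.
by rewrite -(@Gauss_dvdl _ _ n) // eq1 dvdn_mulr.
Qed.

Lemma prime_not_sqr (p : nat) (x : int) : prime p -> p%:Z <> x ^+ 2.
Proof.
move=> pp h; have : p = (`|x| ^ 2)%N by lia.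
move=> pE; have := pfactorK 1 pp.
by rewrite expn1 {2}pE lognX; lia.
Qed.

Lemma sqr_mod8 (c : int) :
  exists m : int, c ^+ 2 = 8 * m \/ c ^+ 2 = 8 * m + 1 \/ c ^+ 2 = 8 * m + 4.
Proof.
have [k [r [-> hr]]] : exists k r : int, c = 4 * k + r /\ (0 <= r < 4).
  by exists (c %/ 4)%Z, (c %% 4)%Z; lia.
have [->|[->|[->|->]]] : r = 0 \/ r = 1 \/ r = 2 \/ r = 3 by lia.
- by exists (2 * k ^+ 2); left; ring.
- by exists (2 * k ^+ 2 + k); right; left; ring.
- by exists (2 * k ^+ 2 + 2 * k); right; right; ring.
- by exists (2 * k ^+ 2 + 3 * k + 1); right; left; ring.
Qed.

(** As p divides (a d - b c) (a d + b c), it divides a d - b c for a suitable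
    sign of d, and p^2 = (a c + D b d)^2 + D (a d - b c)^2 leaves
    a d - b c = 0, or D = 1, a d - b c = p or -p, and a c + b d = 0. *)
Lemma prime_sqr_form_unique (p : nat) (D a b c d : int) :
  prime p -> 0 < D ->
  p%:Z = a ^+ 2 + D * b ^+ 2 -> p%:Z = c ^+ 2 + D * d ^+ 2 ->
  a ^+ 2 = c ^+ 2 \/ D = 1 /\ a ^+ 2 = d ^+ 2.
Proof.
move=> pp D0 hab hcd.
have p0 : p%:Z != 0 by move: (prime_gt0 pp); lia.
wlog [m hm] : d hcd / exists m : int, a * d - b * c = p%:Z * m => [hw|].
  have : (p%:Z %| (a * d - b * c) * (a * d + b * c))%Z.
    apply/dvdzP; exists (d ^+ 2 - b ^+ 2).
    have -> : (d ^+ 2 - b ^+ 2) * p%:Z = d ^+ 2 * p%:Z - b ^+ 2 * p%:Z by ring.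
    by rewrite {1}hab {1}hcd; ring.
  rewrite dvdzE abszM Euclid_dvdM // => /orP[] h.
    apply: hw hcd _; have /dvdzP[m ->] : (p%:Z %| (a * d - b * c)%R)%Z by rewrite dvdzE.
    by exists m; rewrite mulrC.
  have [||h1|[D1 h1]] := hw (- d); [by rewrite sqrrN| |by left|by right; rewrite sqrrN in h1].
  have /dvdzP[m hm] : (p%:Z %| (a * d + b * c)%R)%Z by rewrite dvdzE.
  by exists (- m); rewrite [RHS]mulrN [_ * m]mulrC -hm; ring.
have sq : p%:Z ^+ 2 = (a * c + D * b * d) ^+ 2 + D * (p%:Z * m) ^+ 2.
  by rewrite -hm expr2 {1}hab hcd; ring.
have [m0|m0] := eqVneq m 0.
  have adbc : a * d = b * c by apply/eqP; rewrite -subr_eq0 hm m0 mulr0.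
  left; apply: (mulIf p0); rewrite {1}hcd [in RHS]hab.
  have -> : a ^+ 2 * (c ^+ 2 + D * d ^+ 2) = a ^+ 2 * c ^+ 2 + D * (a * d) ^+ 2 by ring.
  by rewrite adbc; ring.
have P0 : 0 < p%:Z ^+ 2 by rewrite exprn_gt0 // ltz_nat prime_gt0.
have M0 : 0 < m ^+ 2 by rewrite exprn_even_gt0.
have [D1 ac0] : D = 1 /\ (a * c + D * b * d) ^+ 2 = 0.
  have := sqr_ge0 (a * c + D * b * d); move: sq P0 M0; rewrite exprMn.
  move: (_ ^+ 2) (p%:Z ^+ 2) (m ^+ 2) => X P M sq P0 M0 X0.
  have DM : D * M <= 1 by rewrite -(ler_pM2l P0); lia.
  have DD : D <= D * M by rewrite ler_peMr //; lia.
  have MM : M <= D * M by rewrite ler_peMl //; lia.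
  have D1 : D = 1 by lia.
  have M1 : M = 1 by lia.
  by split=> //; move: sq; rewrite D1 M1; lia.
right; split=> //; apply: (mulIf p0); rewrite {1}hcd [in RHS]hab D1.
move: ac0; rewrite D1 => /eqP; rewrite sqrf_eq0 => /eqP ac.
have {}ac : a * c = - (b * d) by apply/eqP; rewrite -addr_eq0 -[b]mul1r ac.
have -> : a ^+ 2 * (c ^+ 2 + 1 * d ^+ 2) = (a * c) ^+ 2 + a ^+ 2 * d ^+ 2 by ring.
by rewrite ac; ring.
Qed.

(** Put s = 2 m + 7, so that m (m + 7) = 2 u^2 with coprime factors, one a
    square and the other twice a square (7 divides neither, as it would divide
    p). If m = r^2 and m + 7 = 2 t^2 with r odd, then 8 divides 2 t^2, so that
    t and u = r t are even. If m = 2 t^2 and m + 7 = r^2, then r^2 + t^2 is 1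
    modulo 3, so that 3 divides u = r t and p. *)
Lemma even_of_two_forms (p : nat) (s u : int) :
  prime p -> p%:Z = 8 * s ^+ 2 + 49 -> p%:Z = 64 * u ^+ 2 + 441 ->
  ~~ (2 %| s)%Z -> (2 %| u)%Z.
Proof.
move=> pp hs hu s_odd.
have {hs}hs : (`|s| ^ 2 = 49 + 8 * `|u| ^ 2)%N by lia.
have {hu}hu : (p = 64 * `|u| ^ 2 + 441)%N by lia.
have {s_odd} : odd `|s| by lia.
rewrite (_ : (2 %| u)%Z = ~~ odd `|u|); last by lia.
move: `|s|%N `|u|%N hs hu => S U hS hU oddS.
have S7 : (7 <= S)%N by rewrite -leq_sqr hS leq_addr.
have [m SE] : exists m, S = (2 * m + 7)%N by exists ((S - 7) %/ 2)%N; lia.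
have mU : (m * (m + 7) = 2 * U ^ 2)%N by move: hS; rewrite SE; lia.
have not_dvd d : prime d -> d != p -> (d %| 441)%N -> ~~ (d %| U)%N.
  move=> pd dp d441; apply: contra dp => dU; rewrite -dvdn_prime2 //.
  by rewrite hU dvdn_add // dvdn_mull // Euclid_dvdX // dU.
have nU3 : ~~ (3 %| U)%N by apply: not_dvd => //; lia.
have nU7 : ~~ (7 %| U)%N by apply: not_dvd => //; lia.
have nm7 : ~~ (7 %| m)%N.
  apply: contra nU7 => m7; have : (7 %| 2 * U ^ 2)%N by rewrite -mU dvdn_mulr.
  by rewrite Euclid_dvdM // Euclid_dvdX // andbT.
have co7 : coprime m 7 by rewrite coprime_sym prime_coprime.
have [om|em] := boolP (odd m).
  have [n nE] : exists n, (m + 7 = 2 * n)%N by exists ((m + 7) %/ 2)%N; lia.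
  have mn : (m * n = U ^ 2)%N by move: mU; rewrite nE; lia.
  have co : coprime m n.
    have : coprime m (m + 7) by rewrite /coprime gcdnDl.
    by rewrite nE coprimeMr => /andP[].
  have [r rE] := coprime_mul_sqr co mn.
  have [t tE] : exists t, n = (t ^ 2)%N.
    by apply: (@coprime_mul_sqr n m U); rewrite 1?coprime_sym // mulnC.
  have UE : U = (r * t)%N by apply/eqP; rewrite -eqn_sqr expnMn -rE -tE mn.
  have {}om : odd r by move: om; rewrite rE oddX.
  have [k kE] : exists k, r = (2 * k + 1)%N by exists (r %/ 2)%N; lia.
  rewrite UE oddM om /=; apply/negP => ot.
  have [l lE] : exists l, t = (2 * l + 1)%N by exists (t %/ 2)%N; lia.
  by move: nE; rewrite rE tE kE lE; lia.
have [n nE] : exists n, m = (2 * n)%N by exists (m %/ 2)%N; lia.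
have mn : (n * (m + 7) = U ^ 2)%N by move: mU; rewrite {1}nE; lia.
have co : coprime n (m + 7).
  have : coprime m (m + 7) by rewrite /coprime gcdnDl.
  by rewrite {1}nE coprimeMl => /andP[].
have [t tE] := coprime_mul_sqr co mn.
have [r rE] : exists r, (m + 7)%N = (r ^ 2)%N.
  by apply: (@coprime_mul_sqr _ n U); rewrite 1?coprime_sym // mulnC.
have UE : U = (t * r)%N by apply/eqP; rewrite -eqn_sqr expnMn -rE -tE mn.
move: nU3; rewrite UE Euclid_dvdM // negb_or => /andP[t3 r3].
have rt : (r ^ 2 = 2 * t ^ 2 + 7)%N by rewrite -rE nE tE.
have sq3 c : ~~ (3 %| c)%N -> exists k, (c ^ 2 = 3 * k + 1)%N.
  move=> c3; have [k [kE|kE]] : exists k, c = (3 * k + 1)%N \/ c = (3 * k + 2)%N.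
    by exists (c %/ 3)%N; lia.
    by exists (3 * k ^ 2 + 2 * k)%N; rewrite kE; lia.
  by exists (3 * k ^ 2 + 4 * k + 1)%N; rewrite kE; lia.
have [i ri] := sq3 r r3; have [j tj] := sq3 t t3.
by move: rt; rewrite ri tj; lia.
Qed.

(** * When the difference counts take two consecutive values *)

Lemma nontrivial_almost_difference_setP (G : finZmodType) (D : {set G}) (v : nat) :
  #|G| = v ->
  (exists k lambda t : nat, (0 < t < v.-1)%N /\
     almost_difference_set v k lambda t D) <->
  exists lambda : nat,
    [/\ forall g, g != 0 -> diff_count D g = lambda \/ diff_count D g = lambda.+1,
        exists2 g, g != 0 & diff_count D g = lambda &
        exists2 g, g != 0 & diff_count D g = lambda.+1].
Proof.
move=> <-.
pose L l := [set g : G | (g != 0) && (diff_count D g == l)].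
split=> [[k [l [t [/andP[t0 t1] [_ _ cardL only2]]]]]|[l [only2 [g0 g00 hg0] [g1 g10 hg1]]]].
  exists l; split=> [g g0||].
  - by have [|/eqP/(only2 g g0)] := eqVneq (diff_count D g) l; [left|right].
  - have /card_gt0P[g] : (0 < #|L l|)%N by rewrite cardL.
    by rewrite inE => /andP[g0 /eqP]; exists g.
  have : [set~ 0] \notin powerset (L l).
    rewrite powersetE; apply: contraTN t1 => /subset_leq_card.
    by rewrite cardL cardsC1 -leqNgt.
  rewrite powersetE => /subsetPn[g]; rewrite !inE => g0.
  rewrite g0 /= => /eqP gl; exists g => //; exact: only2.
exists #|D|, l, #|L l|; split; last first.
  by split=> // g gn0 gl; have [|] := only2 g gn0.
apply/andP; split; first by apply/card_gt0P; exists g0; rewrite inE g00 hg0 /=.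
rewrite -(cardsC1 (0 : G)); apply: proper_card; apply/properP; split.
  by apply/subsetP => g; rewrite !inE => /andP[].
exists g1; first by rewrite !inE.
by rewrite inE g10 hg1 /=; lia.
Qed.

(** The entries stand for 64 times difference counts, so that consecutive
    counts are 64 apart. *)
Definition two_valued (v : seq int) : Prop :=
  exists l : int, [/\ {subset v <= [:: l; l + 64]}, l \in v & l + 64 \in v].

Lemma two_valued_diff v i j : two_valued v -> (i < size v)%N -> (j < size v)%N ->
  v`_i - v`_j = 0 \/ v`_i - v`_j = 64 \/ v`_i - v`_j = - 64.
Proof.
move=> [l [sub _ _]] hi hj.
have := sub _ (mem_nth 0 hi); have := sub _ (mem_nth 0 hj).
by rewrite !inE => /orP[]/eqP-> /orP[]/eqP->; lia.
Qed.

Lemma half_of_sqr (c m : int) :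
  c ^+ 2 = 4 * m -> exists2 d, c = 2 * d & d ^+ 2 = m.
Proof.
have [d [->|->]] : exists d : int, c = 2 * d \/ c = 2 * d + 1.
  by exists (c %/ 2)%Z; lia.
  by move=> h; exists d => //; lia.
by lia.
Qed.

Lemma sqr_mod3 (c : int) : exists m : int, c ^+ 2 = 3 * m \/ c ^+ 2 = 3 * m + 1.
Proof.
have [k [->|[->|->]]] : exists k : int, c = 3 * k \/ c = 3 * k + 1 \/ c = 3 * k + 2.
- by exists (c %/ 3)%Z; lia.
- by exists (3 * k ^+ 2); left; ring.
- by exists (3 * k ^+ 2 + 2 * k); right; ring.
by exists (3 * k ^+ 2 + 4 * k + 1); right; ring.
Qed.

Lemma sqr_mod32_neq20 (b m : int) : b ^+ 2 <> 32 * m + 20.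
Proof.
move=> b20; have [c _ c2] : exists2 c, b = 2 * c & c ^+ 2 = 8 * m + 5.
  by apply: half_of_sqr; rewrite b20; ring.
by have [m' hm'] := sqr_mod8 c; clear b20; lia.
Qed.

Section SignCases.
Context (q a b x y : int).
Let diff v tv i j hi hj := @two_valued_diff v i j tv hi hj.

(** The differences of the entries 1, 3, 5, 7 are 16 y, 32 b and
    16 y + 32 b, 16 y - 32 b up to sign. If the first two are 64 or -64, then
    one of the last two is 128 or -128. *)
Lemma two_valued_even_quartic :
  b != 0 -> y != 0 -> ~ two_valued (octic_values q 1 1 a b x y).
Proof.
move=> b0 y0 tv; move: (diff tv (isT : 1 < 8)%N (isT : 3 < 8)%N).
move: (diff tv (isT : 1 < 8)%N (isT : 5 < 8)%N).
move: (diff tv (isT : 1 < 8)%N (isT : 7 < 8)%N).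
move: (diff tv (isT : 3 < 8)%N (isT : 5 < 8)%N).
rewrite /octic_values /= {tv}; lia.
Qed.

Lemma two_valued_even_nonquartic :
  y != 0 -> two_valued (octic_values q 1 (-1) a b x y) ->
  y ^+ 2 = 16 /\ (x = -1 \/ x = 3 \/ x = -5).
Proof.
move=> y0 tv; move: (diff tv (isT : 2 < 8)%N (isT : 6 < 8)%N).
move: (diff tv (isT : 0 < 8)%N (isT : 4 < 8)%N).
rewrite /octic_values /= {tv} => h04 h26.
have y4 : y = 4 \/ y = -4 by lia.
by split; [case: y4 => ->|lia].
Qed.

Lemma two_valued_odd_nonquartic :
  y != 0 -> two_valued (octic_values q (-1) (-1) a b x y) ->
  y ^+ 2 = 16 /\ (x = 3 \/ x = -5).
Proof.
move=> y0 tv; move: (diff tv (isT : 1 < 8)%N (isT : 3 < 8)%N).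
move: (diff tv (isT : 0 < 8)%N (isT : 1 < 8)%N).
move: (diff tv (isT : 0 < 8)%N (isT : 3 < 8)%N).
move: (diff tv (isT : 2 < 8)%N (isT : 1 < 8)%N).
move: (diff tv (isT : 2 < 8)%N (isT : 3 < 8)%N).
rewrite /octic_values /= {tv} => h23 h21 h03 h01 h13.
have y4 : y = 4 \/ y = -4 by clear -y0 h13; lia.
split; first by case: y4 => ->.
by case: y4 h23 h21 h03 h01 => -> {y0 h13}; lia.
Qed.

(** Here the entries take only three values, so two differences are linear
    conditions on (a, x). The solution (1, 3) makes all entries equal: these
    are the ordinary difference sets, such as the one for p = 73. *)
Lemma two_valued_odd_quartic :
  two_valued (octic_values q (-1) 1 a b x y) ->
  (a = 1 /\ (x = 19 \/ x = -13)) \/ (a = 9 /\ (x = 11 \/ x = 27)) \/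
  (a = -7 /\ (x = -5 \/ x = -21)).
Proof.
move=> tv; move: (diff tv (isT : 0 < 8)%N (isT : 1 < 8)%N).
move: (diff tv (isT : 0 < 8)%N (isT : 2 < 8)%N).
move: (diff tv (isT : 2 < 8)%N (isT : 1 < 8)%N).
rewrite {1 2 3 4 5 6}/octic_values /= => h21 h02 h01.
have [[a1 x3]|//] : (a = 1 /\ x = 3) \/ (a = 1 /\ (x = 19 \/ x = -13)) \/
    (a = 9 /\ (x = 11 \/ x = 27)) \/ (a = -7 /\ (x = -5 \/ x = -21)).
  by clear tv; lia.
case: tv => l [sub l0 l64].
have eqv t : t \in octic_values q (-1) 1 a b x y -> t = q - 9.
  rewrite /octic_values a1 x3 !inE.
  by do 7?[case/orP]; move=> /eqP ->; ring.
by have := eqv _ l0; have := eqv _ l64; lia.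
Qed.

End SignCases.

Lemma sqr_eqP (c d : int) : c ^+ 2 = d ^+ 2 -> c = d \/ c = - d.
Proof. by move=> /eqP; rewrite eqf_sqr => /orP[]/eqP; [left|right]. Qed.

Section Arithmetic.
Context (p f : nat) (o a b x y : int).
Context (p_prime : prime p) (pE : p = (8 * f).+1).
Context (o_sign : o = 1 \/ o = -1).
Context (p_ab : p%:Z = a ^+ 2 + 2 * b ^+ 2).
Context (p_xy : p%:Z = x ^+ 2 + y ^+ 2).
Let v := octic_values p%:Z ((-1) ^+ f) o a b x y.
Context (v_div : forall k, (k < 8)%N -> exists n : nat, v`_k = 64 * n%:Z).

Lemma two_valued_necessary : two_valued v ->
  p = 17%N \/ p = 41%N \/
  exists s u : int,
    [/\ ~~ (2 %| s)%Z, (2 %| u)%Z,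
        p%:Z = 8 * s ^+ 2 + 49 & p%:Z = 64 * u ^+ 2 + 441].
Proof.
move=> tv.
have b0 : b != 0.
  by apply/eqP => b0; apply: (@prime_not_sqr p a p_prime); rewrite p_ab b0; ring.
have y0 : y != 0.
  by apply/eqP => y0; apply: (@prime_not_sqr p x p_prime); rewrite p_xy y0; ring.
have n25 : p <> 25%N by move=> p25; move: p_prime; rewrite p25.
have [e1|em1] : (-1) ^+ f = 1 :> int \/ (-1) ^+ f = -1 :> int.
  by rewrite -signr_odd; case: odd; [right|left].
  move: tv; rewrite /v e1; have [->|->] := o_sign.
    by move/(two_valued_even_quartic b0 y0).
  move=> /(two_valued_even_nonquartic y0)[y16].
  by move: p_xy n25; rewrite y16; clear => pxy n25 [xE|[xE|xE]]; move: pxy; rewrite xE; lia.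
have [o1|om1] := o_sign; last first.
  move: tv; rewrite /v em1 om1 => /(two_valued_odd_nonquartic y0)[y16].
  by move: p_xy n25; rewrite y16; clear => pxy n25 [xE|xE]; move: pxy; rewrite xE; lia.
right; right; have [n0] := v_div (isT : (0 < 8)%N).
move: tv; rewrite /v em1 o1 => /two_valued_odd_quartic cases.
rewrite /octic_values /= => hn0.
have {}hn0 : p%:Z - 15 + 2 * x = 64 * n0%:Z by rewrite -hn0; ring.
case: cases => [[aE [xE|xE]]|[[aE [xE|xE]]|[aE [xE|xE]]]];
  move: p_ab p_xy hn0; rewrite aE xE => p_b p_y hn0.
- by exfalso; apply: (@sqr_mod32_neq20 b (n0%:Z - 1)); clear -p_b hn0; lia.
- by exfalso; apply: (@sqr_mod32_neq20 b n0%:Z); clear -p_b hn0; lia.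
- by exfalso; apply: (@sqr_mod32_neq20 b (n0%:Z - 2)); clear -p_b hn0; lia.
- have [m hb] := sqr_mod3 b; have [m' hy] := sqr_mod3 y.
  (* 81 + 2 b^2 = 729 + y^2 is solvable modulo powers of 2, but forces 3 | b *)
  have p3 : (3 %| p)%N by clear -hb hy p_b p_y; lia.
  by move: p3; rewrite dvdn_prime2 // => /eqP p3; move: p_b; have := sqr_ge0 b; clear -p3; lia.
- by exfalso; apply: (@sqr_mod32_neq20 b (n0%:Z - 1)); clear -p_b hn0; lia.
have [s _ s2] : exists2 s, b = 2 * s & s ^+ 2 = 1 + 8 * n0%:Z.
  by apply: half_of_sqr; clear -p_b hn0; lia.
have [y1 _ hy1] : exists2 y1, y = 2 * y1 & y1 ^+ 2 = 16 * (n0%:Z - 6).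
  by apply: half_of_sqr; clear -p_y hn0; lia.
have [y2 _ hy2] : exists2 y2, y1 = 2 * y2 & y2 ^+ 2 = 4 * (n0%:Z - 6).
  by apply: half_of_sqr; rewrite hy1; ring.
have [u _ u2] := half_of_sqr hy2.
have s_odd : ~~ (2 %| s)%Z.
  by apply/negP => /dvdzP[k sk]; move: s2; rewrite sk; clear; lia.
have ps : p%:Z = 8 * s ^+ 2 + 49 by clear -s2 hn0; lia.
have pu : p%:Z = 64 * u ^+ 2 + 441 by clear -u2 hn0; lia.
by exists s, u; split=> //; apply: even_of_two_forms ps pu s_odd.
Qed.

Lemma ab_unique (c d : int) :
  p%:Z = c ^+ 2 + 2 * d ^+ 2 -> (a = c \/ a = - c) /\ (b = d \/ b = - d).
Proof.
move=> p_cd.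
have [ac|[]//] := prime_sqr_form_unique p_prime (ltr0Sn _ 1) p_ab p_cd.
by split; apply: sqr_eqP => //; move: p_ab; rewrite p_cd ac; clear; lia.
Qed.

Lemma xy_unique (c d : int) : p%:Z = c ^+ 2 + d ^+ 2 ->
  (x = c \/ x = - c) /\ (y = d \/ y = - d) \/
  (x = d \/ x = - d) /\ (y = c \/ y = - c).
Proof.
move=> p_cd.
have p_xy1 : p%:Z = x ^+ 2 + 1 * y ^+ 2 by rewrite mul1r.
have p_cd1 : p%:Z = c ^+ 2 + 1 * d ^+ 2 by rewrite mul1r.
have [xc|[_ xd]] := prime_sqr_form_unique p_prime ltr01 p_xy1 p_cd1.
  by left; split; apply: sqr_eqP => //; move: p_xy; rewrite p_cd xc; clear; lia.
by right; split; apply: sqr_eqP => //; move: p_xy; rewrite p_cd xd; clear; lia.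
Qed.

(** From 17 = 3^2 + 2 * 2^2 = 1^2 + 4^2 the numbers a, x, y are known up to sign
    and order; that the entries are multiples of 64 then gives o = -1, x = -1
    and a = 3. *)
Lemma two_valued17 : p = 17%N -> two_valued v.
Proof.
move=> p17; have f2 : f = 2 by clear -pE p17; lia.
have [a3 b2] : (a = 3 \/ a = -3) /\ (b = 2 \/ b = -2).
  by apply: (@ab_unique 3 2); rewrite p17.
have xy : (x = 1 \/ x = -1) /\ (y = 4 \/ y = -4) \/
          (x = 4 \/ x = -4) /\ (y = 1 \/ y = -1).
  by apply: (@xy_unique 1 4); rewrite p17.
have [n0] := v_div (isT : 0 < 8)%N; have [n2] := v_div (isT : 2 < 8)%N.
rewrite /v /octic_values p17 f2 /=; case: o_sign => -> v2 v0.
  by exfalso; clear -v2 xy; lia.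
have xE : x = -1 by clear -v0 xy; lia.
have y4 : y = 4 \/ y = -4 by clear -xE xy; lia.
have aE : a = 3 by clear -a3 xE y4 v2; lia.
by exists 0; rewrite xE aE; case: y4 => ->; case: b2 => ->; split=> //; apply/allP.
Qed.

Lemma two_valued41 : p = 41%N -> two_valued v.
Proof.
move=> p41; have f5 : f = 5 by clear -pE p41; lia.
have [a3 b4] : (a = 3 \/ a = -3) /\ (b = 4 \/ b = -4).
  by apply: (@ab_unique 3 4); rewrite p41.
have xy : (x = 5 \/ x = -5) /\ (y = 4 \/ y = -4) \/
          (x = 4 \/ x = -4) /\ (y = 5 \/ y = -5).
  by apply: (@xy_unique 5 4); rewrite p41.
have [n0] := v_div (isT : 0 < 8)%N; have [n2] := v_div (isT : 2 < 8)%N.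
rewrite /v /octic_values p41 f5 /=; case: o_sign => -> v2 v0.
  by exfalso; clear -v0 xy; lia.
have xE : x = -5 by clear -v2 xy; lia.
have y4 : y = 4 \/ y = -4 by clear -xE xy; lia.
have aE : a = -3 by clear -a3 xE v0; lia.
by exists 0; rewrite xE aE; case: y4 => ->; case: b4 => ->; split=> //; apply/allP.
Qed.

(** Since s is odd, p is 57 modulo 64. Uniqueness gives a = 7 or -7 and
    x = 21, -21, 8 u or -8 u, and divisibility by 64 leaves o = 1, x = -21 and
    a = -7. *)
Lemma two_valued_two_forms (s u : int) :
  ~~ (2 %| s)%Z -> p%:Z = 8 * s ^+ 2 + 49 -> p%:Z = 64 * u ^+ 2 + 441 ->
  two_valued v.
Proof.
move=> s_odd ps pu.
have [t sE] : exists t, s = 2 * t + 1 by exists (s %/ 2)%Z; clear -s_odd; lia.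
have [k sk] : exists k, s ^+ 2 = 8 * k + 1.
  by have [k sk] := sqr_mod8 s; exists k; move: sk; rewrite sE; clear; lia.
have f_odd : odd f by clear -pE ps sk; lia.
have em1 : (-1) ^+ f = -1 :> int by rewrite -signr_odd f_odd.
have [a7 _] : (a = 7 \/ a = -7) /\ (b = 2 * s \/ b = - (2 * s)).
  by apply: ab_unique; rewrite ps; ring.
have xy : (x = 21 \/ x = -21) /\ (y = 8 * u \/ y = - (8 * u)) \/
          (x = 8 * u \/ x = - (8 * u)) /\ (y = 21 \/ y = -21).
  by apply: (@xy_unique 21 (8 * u)); rewrite pu; ring.
have [n0] := v_div (isT : 0 < 8)%N; have [n2] := v_div (isT : 2 < 8)%N.
have pk : p%:Z = 64 * k + 57 by clear -ps sk; lia.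
rewrite /v em1 pk; case: o_sign => ->.
  rewrite {1 2}/octic_values /= => v2 v0.
  have xE : x = -21 by clear -xy v0; lia.
  have aE : a = -7 by clear -a7 v2 xE; lia.
  have -> : octic_values (64 * k + 57) (-1) 1 a b x y =
    [:: 64 * k; 64 * k + 64; 64 * k + 64; 64 * k + 64;
        64 * k; 64 * k + 64; 64 * k + 64; 64 * k + 64].
    by rewrite /octic_values aE xE; congr [:: _; _; _; _; _; _; _; _]; ring.
  exists (64 * k); rewrite !inE !eqxx ?orbT; split=> // r.
  by rewrite !inE; do 7?[case/orP]; move=> ->; rewrite ?orbT.
rewrite {1 2}/octic_values /= => v2 v0.
by exfalso; clear -xy v2; lia.
Qed.

End Arithmetic.

Theorem theorem12 (p : nat) (p_prime : prime p) (p_mod8 : p = 1 %[mod 8]) :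
  typeO_almost_difference_set p <->
  p = 17%N \/ p = 41%N \/
  exists s u : int,
    [/\ ~~ (2 %| s)%Z, (2 %| u)%Z,
        p%:Z = 8 * s ^+ 2 + 49 & p%:Z = 64 * u ^+ 2 + 441].
Proof.
have cardF : #|'F_p| = p := card_Fp p_prime.
have [f pE] : exists f, p = (8 * f).+1 by exists (p %/ 8)%N; lia.
have [w prim_w] := finField_primitive_root 'F_p.
have card8 : #|'F_p| = (8 * f).+1 by rewrite cardF.
rewrite card8 /= in prim_w.
have [o [a [b [x [y [o_sign p_ab p_xy count_w]]]]]] := octic_diff_counts card8 prim_w.
rewrite cardF in p_ab p_xy count_w.
set v := octic_values _ _ _ _ _ _ _ in count_w.
pose N g := diff_count (octic_residues p) g.
have {}count_w k : 64 * (N (w ^+ k))%:Z = v`_(k %% 8) := count_w k.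
have v_div k : (k < 8)%N -> exists n : nat, v`_k = 64 * n%:Z.
  by move=> k8; exists (N (w ^+ k)); rewrite count_w modn_small.
have pow_w g : g != 0 -> exists k, g = w ^+ k := unit_powP card8 prim_w (x := g).
have w_pow k : w ^+ k != 0 := primitive_root_neq0 prim_w k.
have -> : typeO_almost_difference_set p <-> two_valued v.
  rewrite /typeO_almost_difference_set (nontrivial_almost_difference_setP _ cardF).
  have mem_v g : g != 0 -> 64 * (N g)%:Z \in v.
    by move=> /pow_w[k ->]; rewrite count_w mem_nth // ltn_mod.
  have vP r : r \in v -> exists2 g, g != 0 & r = 64 * (N g)%:Z.
    by move=> /(nthP 0)[k k8 <-]; exists (w ^+ k); rewrite // count_w modn_small.
  split=> [[l [only2 [g g0 gl] [h h0 hl]]]|[r [sub r0 r1]]].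
    exists (64 * l%:Z); split.
    - move=> _ /vP[k k0 ->]; rewrite !inE; have := only2 k k0; rewrite -/(N k).
      by clear; lia.
    - by rewrite -gl; apply: mem_v.
    by rewrite (_ : _ + _ = 64 * l.+1%:Z) -?hl; [apply: mem_v|lia].
  have [g g0 gl] := vP _ r0; have [h h0 hl] := vP _ r1.
  exists (N g); split; last first.
  - by exists h => //; move: hl; rewrite gl -/(N h); clear; lia.
  - by exists g.
  move=> k /mem_v/sub; rewrite !inE gl -/(N k); clear; lia.
split; first exact: two_valued_necessary.
case=> [|[|[s [u [s_odd _ ps pu]]]]]; first exact: two_valued17.
  exact: two_valued41.
exact: two_valued_two_forms s_odd ps pu.
Qed.
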